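(* Let $n\geq3$ and $B\in\mathcal{S}^n$. Then $B$ is illuminated by a set of directions consisting of at most $2^{n-1}$ pairs of opposite directions $\{d,-d\}$, and by a set consisting of at most $2^{n-1}-1$ such pairs if $B\neq[-1,1]^n$. Consequently $X(B)\leq2^{n-1}$ (so that $X(B)\leq 3\cdot2^{n-2}$), and moreover $X(B)\leq2^{n-1}-1$ if $B\neq[-1,1]^n$.
   Context: A convex body in $\mathbb{R}^n$ is a compact convex set with non-empty interior. A convex body $B\subset\mathbb{R}^n$ is 1-symmetric if $(x_1,\ldots,x_n)\in B$ implies $(\epsilon_1x_{\sigma(1)},\ldots,\epsilon_nx_{\sigma(n)})\in B$ for all signs $\epsilon_i\in\{\pm1\}$ and all permutations $\sigma$ of $\{1,\ldots,n\}$. $\mathcal{S}^n$ denotes the class of 1-symmetric convex bodies $B\subset\mathbb{R}^n$ with $e_i\in\partial B$ for every standard basis vector $e_i$ (every 1-symmetric convex body has a dilate in $\mathcal{S}^n$). A direction is a non-zero vector; $d$ illuminates a boundary point $x$ of a convex body $K$ if there is $\varepsilon>0$ with $x+\varepsilon d\in\operatorname{int}K$, and a set of directions illuminates $K$ if every boundary point of $K$ is illuminated by at least one of its elements. The X-ray number $X(K)$ of a convex body $K\subset\mathbb{R}^n$ is the minimum number $M$ of non-zero vectors $u_1,\ldots,u_M$ such that for every $p\in\partial K$ there is $i\in\{1,\ldots,M\}$ with $(p+\mathbb{R}u_i)\cap\operatorname{int}K\neq\emptyset$. *)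

(* Defs.v *)
From HB Require Import structures.
From mathcomp Require Import all_boot all_order all_algebra perm.
From mathcomp Require Import all_classical all_reals all_analysis.

Set Implicit Arguments.
Unset Strict Implicit.
Unset Printing Implicit Defensive.

Import Order.TTheory GRing.Theory Num.Theory.
Import numFieldNormedType.Exports.

Local Open Scope classical_set_scope.
Local Open Scope ring_scope.

(* R^n is 'rV[R]_n with its product topology; the norm of the library on
   'rV[R]_n is the sup norm, which induces the same topology. *)

Definition boundary (T : topologicalType) (A : set T) : set T :=
  closure A `\` A°.

Definition convex_body (R : realType) (n : nat) (K : set 'rV[R]_n) : Prop :=
  [/\ compact K, convex_set K & K° !=set0].

Definition one_symmetric (R : realType) (n : nat) (B : set 'rV[R]_n) : Prop :=
  forall (x : 'rV[R]_n) (eps : 'I_n -> R) (s : 'S_n),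
    (forall i, eps i = 1 \/ eps i = -1) ->
    B x -> B (\row_i (eps i * x ord0 (s i))).

(* delta_mx ord0 i is the standard basis vector e_i. *)
Definition classS (R : realType) (n : nat) (B : set 'rV[R]_n) : Prop :=
  [/\ convex_body B, one_symmetric B
    & forall i : 'I_n, boundary B (delta_mx ord0 i)].

Definition cube (R : realType) (n : nat) : set 'rV[R]_n :=
  [set x | forall i, -1 <= x ord0 i <= 1].
Arguments cube : clear implicits.

Definition illuminates (R : realType) (n : nat)
    (K : set 'rV[R]_n) (d x : 'rV[R]_n) : Prop :=
  exists2 e : R, 0 < e & K° (x + e *: d).

Definition illuminating_set (R : realType) (n : nat)
    (K D : set 'rV[R]_n) : Prop :=
  (forall d, D d -> d != 0) /\
  (forall x, boundary K x -> exists2 d, D d & illuminates K d x).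

(* The family d need not be injective, whence "at most". *)
Definition at_most_opposite_pairs (R : realType) (n : nat) (m : nat)
    (D : set 'rV[R]_n) : Prop :=
  exists (k : nat) (d : 'I_k -> 'rV[R]_n),
    (k <= m)%N /\ D = [set x | exists i, x = d i \/ x = - d i].

Definition xrayed_by (R : realType) (n : nat) (K : set 'rV[R]_n) (M : nat)
    (u : 'I_M -> 'rV[R]_n) : Prop :=
  (forall i, u i != 0) /\
  (forall p, boundary K p ->
     exists i, [set p + t *: u i | t in [set: R]] `&` K° !=set0).

(* "X(K) = M".  A relation rather than a function, so that no junk value is
   attached to a set that no finite family X-rays. *)
Definition is_xray_number (R : realType) (n : nat) (K : set 'rV[R]_n)
    (M : nat) : Prop :=
  (exists u : 'I_M -> 'rV[R]_n, xrayed_by K u) /\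
  (forall M' (u : 'I_M' -> 'rV[R]_n), xrayed_by K u -> (M <= M')%N).

Lemma is_xray_number_unique (R : realType) (n : nat) (K : set 'rV[R]_n)
    (M1 M2 : nat) : is_xray_number K M1 -> is_xray_number K M2 -> M1 = M2.
Proof.
move=> [[u1 xu1] min1] [[u2 xu2] min2]; apply/eqP.
by rewrite eqn_leq (min1 _ _ xu2) (min2 _ _ xu1).
Qed.

(* Main.v *)
Require Import Defs.
From HB Require Import structures.
From mathcomp Require Import all_boot all_order all_algebra perm.
From mathcomp Require Import all_classical all_reals all_analysis.
From mathcomp Require Import ring lra.

Set Implicit Arguments.
Unset Strict Implicit.
Unset Printing Implicit Defensive.

Import Order.TTheory GRing.Theory Num.Theory.
Import numFieldNormedType.Exports.

Local Open Scope classical_set_scope.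
Local Open Scope ring_scope.

(** The directions are [direction eta T], one for each set [T] of coordinates
carrying a minus sign.  Their moduli are 1 at one distinguished coordinate
[p = start T], [1/n] elsewhere, except that the cyclic predecessor [p - 1] has
a modulus [eta <= 1/n] adapted to [B].  Since [start] is invariant under complement,
the directions of [T] and of its complement are opposite; keeping the [T] that
avoid coordinate 0 leaves [2 ^ (n - 1)] pairs, and leaving out the pair
belonging to the empty and the full set saves one.

Let [x] be a boundary point, [M] the set of coordinates where [|x_i|] is
maximal and [N] the part of [M] where [x_i > 0].  If [T] meets [M] exactly in
[N] and [start T] lies in [M], then the direction of [T] illuminates [x]
([illuminates_dominant]): all the maximal coordinates shrink, and the decrease
at [p], being larger than the sum of all the other moduli, pays for whatever
the coordinates outside [M] gain, because mass can be moved from [p] to them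
inside [B] by averaging [|x|] with its transpositions.

It remains to find such a [T].  The set [T] is viewed as a two-colouring of the
cycle [Z/n], and [start T] is the beginning of a run of equal colours.
If [N] is neither empty nor [M], colour each point outside [M] like its
predecessor: then every run begins in [M].  If [N] is empty or all of [M], but
[M] is not everything, take [T = {j}] or its complement with [j] outside
[M] and [j + 1] in [M]; for these two kinds of sets [start] is required to
be [j + 1].  Neither choice of [T] is empty or full.

The only points left are those with all [x_i] equal to some [a <> 0]; the empty
or the full set takes care of them.  When [B] is not the cube these two can be
dispensed with: then [|a| < 1], and the direction of [{0}] or of its complement
has a wrong sign only at coordinate 0, where its modulus is [eta], which is
affordable as soon as [eta] is small compared with [1 - |a|]
([illuminates_near_constant]).  Finally each pair of opposite directions gives
one line direction X-raying the same boundary points. *)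

(** * Convexity and symmetry *)

Lemma convex_combination (R : realType) (n : nat) (B : set 'rV[R]_n)
    (s : R) (x y : 'rV[R]_n) :
  convex_set B -> B x -> B y -> 0 <= s <= 1 -> B (s *: x + (1 - s) *: y).
Proof.
move=> cB Bx By s01.
have := cB x y (Itv01 (andP s01).1 (andP s01).2).
by rewrite !inE; apply.
Qed.

(** Induction on the family: peeling off [v k] leaves the weights
[a i / (1 - a k)], whose sum is still less than 1. *)
Lemma weighted_pull (R : realType) (n : nat) (B : set 'rV[R]_n) (I : eqType)
    (l : seq I) (P : pred I) (a : I -> R) (v : I -> 'rV[R]_n) (y : 'rV[R]_n) :
  convex_set B -> B y -> (forall i, P i -> B (v i)) ->
  (forall i, P i -> 0 <= a i) -> \sum_(i <- l | P i) a i < 1 ->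
  B (y + \sum_(i <- l | P i) a i *: (v i - y)).
Proof.
move=> cB By Bv; elim: l a => [|k l IH] a a0; first by rewrite !big_nil addr0.
rewrite !big_cons; case: ifP => [Pk|_]; last exact: IH.
move=> suma.
have rest0 : 0 <= \sum_(i <- l | P i) a i by exact: sumr_ge0.
have ak := a0 _ Pk.
have ak1 : 0 < 1 - a k by lra.
have := IH (fun i => a i / (1 - a k)).
rewrite -mulr_suml ltr_pdivrMr// mul1r => IHk.
have Bz : B (y + \sum_(i <- l | P i) (a i / (1 - a k)) *: (v i - y)).
  apply: IHk; last by lra.
  by move=> i Pi; rewrite divr_ge0 ?a0// ltW.
have -> : y + (a k *: (v k - y) + \sum_(i <- l | P i) a i *: (v i - y))
  = a k *: v k + (1 - a k) *: (y + \sum_(i <- l | P i)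
                                   (a i / (1 - a k)) *: (v i - y)).
  rewrite [(1 - a k) *: (y + _)]scalerDr scaler_sumr.
  rewrite [X in _ + (_ + X) = _](eq_bigr
    (fun i => (1 - a k) *: ((a i / (1 - a k)) *: (v i - y)))); last first.
    by move=> i _; rewrite scalerA mulrC divfK// gt_eqF.
  rewrite !addrA; congr (_ + _).
  by rewrite scalerBr scalerBl scale1r addrCA addrA.
by apply: convex_combination; [|exact: Bv| |apply/andP; split; lra].
Qed.

Lemma one_symmetric_sign (R : realType) (n : nat) (B : set 'rV[R]_n)
    (x : 'rV[R]_n) (eps : 'I_n -> R) :
  one_symmetric B -> (forall i, eps i = 1 \/ eps i = -1) ->
  B x -> B (\row_i (eps i * x ord0 i)).
Proof.
move=> sB epsP Bx; have := sB x eps 1%g epsP Bx.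
by congr (B _); apply/rowP => i; rewrite !mxE perm1.
Qed.

Lemma one_symmetric_perm (R : realType) (n : nat) (B : set 'rV[R]_n)
    (x : 'rV[R]_n) (s : 'S_n) :
  one_symmetric B -> B x -> B (\row_i x ord0 (s i)).
Proof.
move=> sB Bx; have := sB x (fun=> 1) s (fun=> or_introl erefl) Bx.
by congr (B _); apply/rowP => i; rewrite !mxE mul1r.
Qed.

(** The coordinates are changed one at a time: a smaller value of coordinate
[k] is a convex combination of [z] with its reflection in that coordinate. *)
Lemma box_subset (R : realType) (n : nat) (B : set 'rV[R]_n) (z v : 'rV[R]_n) :
  convex_set B -> one_symmetric B -> B z ->
  (forall i, `|v ord0 i| <= z ord0 i) -> B v.
Proof.
move=> cB sB Bz vz.
suff mix (l : seq 'I_n) :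
    B (\row_i (if i \in l then v ord0 i else z ord0 i)).
  by have := mix (enum 'I_n); congr (B _); apply/rowP => i; rewrite !mxE mem_enum.
elim: l => [|k l IH].
  by move: Bz; congr (B _); apply/rowP => i; rewrite !mxE in_nil.
case: (boolP (k \in l)) => kl.
  move: IH; congr (B _); apply/rowP => i; rewrite !mxE in_cons.
  by case: eqVneq => // ->; rewrite kl.
set u := (X in B X) in IH.
have [zk0|zk0] := eqVneq (z ord0 k) 0.
  move: IH; congr (B _); apply/rowP => i; rewrite !mxE in_cons.
  case: eqVneq => //= ->; rewrite (negbTE kl) zk0.
  by move: (vz k); rewrite zk0 normr_le0 => /eqP.
have zk : 0 < z ord0 k by rewrite lt0r zk0 (le_trans _ (vz k)).
pose eps i : R := if i == k then -1 else 1.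
have epsP i : eps i = 1 \/ eps i = -1 by rewrite /eps; case: ifP; [right|left].
have Bu' := one_symmetric_sign sB epsP IH.
set r := v ord0 k / z ord0 k.
have rz : r * z ord0 k = v ord0 k by rewrite divfK.
have /andP[r1 r2] : -1 <= r <= 1.
  by rewrite -ler_norml normrM normfV ler_pdivrMr ?normr_gt0//
    mul1r (ger0_norm (ltW zk)) vz.
have := convex_combination (s := (1 + r) / 2) cB IH Bu'.
have s01 : 0 <= (1 + r) / 2 <= 1 by lra.
move=> /(_ s01); congr (B _); apply/rowP => i; rewrite !mxE in_cons /eps.
case: eqVneq => [->|_] /=; last by lra.
rewrite (negbTE kl) -rz; lra.
Qed.

(** The open box spanned by [z] is a neighbourhood of [v] contained in [B]. *)
Lemma interior_box (R : realType) (n : nat) (B : set 'rV[R]_n)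
    (z v : 'rV[R]_n) :
  convex_set B -> one_symmetric B -> B z ->
  (forall i, `|v ord0 i| < z ord0 i) -> B° v.
Proof.
move=> cB sB Bz vz.
have near_i (i : 'I_n) : nbhs v [set w : 'rV[R]_n | `|w ord0 i| < z ord0 i].
  have cn : {for v, continuous (fun w : 'rV[R]_n => `|w ord0 i|)}.
    apply: (@continuous_comp _ _ _ (fun w : 'rV[R]_n => w ord0 i) Num.norm).
      exact: coord_continuous.
    exact: norm_continuous.
  by apply: (cvgr_lt _ cn); exact: vz.
have := filter_forall (nbhs_filter v) near_i.
rewrite /interior /=; apply: filterS => w wz.
apply: (box_subset cB sB Bz) => i; exact: ltW (wz i).
Qed.

Definition absv (R : realType) (n : nat) (x : 'rV[R]_n) : 'rV[R]_n :=
  \row_i `|x ord0 i|.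

Lemma absv_mem (R : realType) (n : nat) (B : set 'rV[R]_n) (x : 'rV[R]_n) :
  one_symmetric B -> B x -> B (absv x).
Proof.
move=> sB Bx.
pose eps i : R := if 0 <= x ord0 i then 1 else -1.
have epsP i : eps i = 1 \/ eps i = -1 by rewrite /eps; case: ifP; [left|right].
suff -> : absv x = \row_i (eps i * x ord0 i) by exact: one_symmetric_sign.
apply/rowP => i; rewrite !mxE /eps.
by case: (ger0P (x ord0 i)) => _; rewrite ?mul1r ?mulN1r.
Qed.

(** * Two illumination criteria *)

Lemma opposite_step (R : realType) (a d : R) (t : R) :
  d * a < 0 -> 0 < t -> t * `|d| <= `|a| -> `|a + t * d| = `|a| - t * `|d|.
Proof.
move=> da t0; have [a0|a0|a0] := ltgtP a 0; last by rewrite a0 mulr0 ltxx in da.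
  have d0 : 0 < d by rewrite -(nmulr_llt0 d a0).
  by rewrite (gtr0_norm d0) (ltr0_norm a0) => ?; rewrite ler0_norm; lra.
have d0 : d < 0 by rewrite -(pmulr_llt0 d a0).
by rewrite (ltr0_norm d0) (gtr0_norm a0) => ?; rewrite ger0_norm; lra.
Qed.

(** With [y = |x|], averaging [y] with its transpositions [(p j)], for the [j]
such that [y_j < y_p], gives a point [z] of [B] in which [y_p] has lost [t S]
and each such [y_j] has gained [t u_j], where [u_j > |d_j|] and
[S = \sum_j u_j < |d_p|].  Then [|x + t d| < z] coordinatewise, so that
[interior_box] applies. *)
Lemma illuminates_dominant (R : realType) (n : nat) (B : set 'rV[R]_n)
    (x d : 'rV[R]_n) (p : 'I_n) :
  convex_set B -> one_symmetric B -> B x ->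
  (forall i, `|x ord0 i| <= `|x ord0 p|) ->
  (forall i, `|x ord0 i| = `|x ord0 p| -> d ord0 i * x ord0 i < 0) ->
  \sum_(j | j != p) `|d ord0 j| < `|d ord0 p| ->
  illuminates B d x.
Proof.
move=> cB sB Bx pmax dM dom.
have n0 : (0 < n)%N by case: (n) p {pmax dM dom} => [[]|].
pose y := absv x.
have yE i : y ord0 i = `|x ord0 i| by rewrite mxE.
have By : B y by exact: absv_mem.
have yp0 : 0 < y ord0 p.
  rewrite yE normr_gt0; apply/eqP => xp; have := dM p erefl.
  by rewrite xp mulr0 ltxx.
pose below := [pred j | y ord0 j < y ord0 p].
(* The slack [kappa] makes [u j] exceed [|d_j|] while the sum of the [u j]
   stays below [|d_p|]. *)
pose kappa := (`|d ord0 p| - \sum_(j | j != p) `|d ord0 j|) / (n%:R *+ 2).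
have kappa0 : 0 < kappa by rewrite divr_gt0 ?subr_gt0// pmulrn_lgt0// ltr0n.
pose u j := `|d ord0 j| + kappa.
have u0 j : 0 < u j by rewrite ltr_wpDl.
have sumu : \sum_(j | below j) u j < `|d ord0 p|.
  have le1 : \sum_(j | below j) u j <= \sum_(j | j != p) u j.
    rewrite big_mkcond [leRHS]big_mkcond /=; apply: ler_sum => j _.
    case: ifP => [jp|_]; last by case: ifP => // _; exact: ltW.
    by case: eqP => // jp'; move: jp; rewrite jp' ltxx.
  apply: (le_lt_trans le1); rewrite big_split /= sumr_const.
  have : kappa *+ #|[pred j | j != p]| <= kappa *+ n.
    by rewrite ler_wpMn2l ?ltW// (leq_trans (max_card _))// card_ord.
  have : kappa *+ n = (`|d ord0 p| - \sum_(j | j != p) `|d ord0 j|) / 2.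
    rewrite /kappa -[n%:R *+ 2]mulr_natr -mulr_natr.
    have : n%:R != 0 :> R by rewrite pnatr_eq0 -lt0n.
    by move=> nn; field.
  by lra.
pose A := \sum_(j | below j) u j / (y ord0 p - y ord0 j).
have A0 : 0 <= A.
  by apply: sumr_ge0 => j jp; rewrite divr_ge0 ?ltW// subr_gt0.
have dp0 : 0 < `|d ord0 p| by apply: le_lt_trans dom; exact: sumr_ge0.
(* The step [t = 1/m] keeps the total weight [t A] of the transpositions
   below 1 and the loss at [p] below [y_p]. *)
pose m := 1 + A + `|d ord0 p| / y ord0 p.
have m0 : 0 < m by rewrite ltr_wpDr ?divr_ge0 ?ltW// ltr_wpDr.
pose t := m^-1.
have t0 : 0 < t by rewrite invr_gt0.
have tA : t * A < 1.
  rewrite mulrC ltr_pdivrMr// mul1r /m.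
  have : 0 <= `|d ord0 p| / y ord0 p by rewrite divr_ge0 ?ltW.
  by lra.
have tdp : t * `|d ord0 p| < y ord0 p.
  rewrite mulrC ltr_pdivrMr// /m mulrDr.
  rewrite [y ord0 p * (_ / _)]mulrC divfK ?gt_eqF//.
  by rewrite ltrDr mulr_gt0// ltr_wpDr.
pose v j := \row_i y ord0 (tperm p j i).
have Bz := @weighted_pull R n B 'I_n (index_enum 'I_n) below
  (fun j => t * (u j / (y ord0 p - y ord0 j))) v y cB By.
have {}Bz := Bz (fun j _ => one_symmetric_perm (tperm p j) sB By).
have {}Bz : B (y + \sum_(j | below j)
                  (t * (u j / (y ord0 p - y ord0 j))) *: (v j - y)).
  apply: Bz; last by rewrite -mulr_sumr.
  by move=> j jp; rewrite mulr_ge0 ?ltW// divr_gt0 ?subr_gt0.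
set z := (X in B X) in Bz.
have term j i : below j ->
    (t * (u j / (y ord0 p - y ord0 j))) * ((v j - y) ord0 i)
    = (if i == j then t * u j else 0) - (if i == p then t * u j else 0).
  move=> jp; have yy : y ord0 p - y ord0 j != 0 by rewrite gt_eqF ?subr_gt0.
  have jp' : j != p by apply: contraTneq jp => ->; rewrite /= ltxx.
  rewrite !mxE; case: tpermP => [->|->|/eqP ip /eqP ij].
  - by rewrite eqxx eq_sym (negbTE jp') -!yE; field.
  - by rewrite eqxx (negbTE jp') -!yE; field.
  - by rewrite (negbTE ip) (negbTE ij) !subrr mulr0.
have zE i : z ord0 i = y ord0 i + \sum_(j | below j)
   ((if i == j then t * u j else 0) - (if i == p then t * u j else 0)).
  rewrite /z mxE summxE; congr (_ + _); apply: eq_bigr => j jp.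
  by rewrite mxE term.
have zbelow i : below i -> z ord0 i = y ord0 i + t * u i.
  move=> ip; rewrite zE (bigD1 i) //= eqxx ifF; last first.
    by apply: contraTF ip => /eqP ->; rewrite /= ltxx.
  rewrite subr0 big1 ?addr0// => j /andP[_ ji].
  rewrite eq_sym (negbTE ji) ifF ?subrr//.
  by apply: contraTF ip => /eqP ->; rewrite /= ltxx.
have zp : z ord0 p = y ord0 p - t * \sum_(j | below j) u j.
  rewrite zE mulr_sumr -sumrN; congr (_ + _); apply: eq_bigr => j jp.
  by rewrite eqxx ifF ?sub0r//; apply: contraTF jp => /eqP <-; rewrite /= ltxx.
have ztop i : ~~ below i -> i != p -> z ord0 i = y ord0 i.
  move=> ip ip'; rewrite zE big1 ?addr0// => j jp.
  rewrite (negbTE ip') ifF ?subrr//; apply: contraNF ip => /eqP ->; exact: jp.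
exists t => //; apply: (interior_box cB sB Bz) => i.
have xi : (x + t *: d) ord0 i = x ord0 i + t * d ord0 i by rewrite !mxE.
rewrite xi; case: (boolP (below i)) => [ib|ib].
  rewrite zbelow// (le_lt_trans (ler_normD _ _))// -yE ltrD2l normrM gtr0_norm//.
  by rewrite ltr_pM2l// /u ltrDl.
have ieq : y ord0 i = y ord0 p.
  by apply/eqP; rewrite eq_le; apply/andP; split; [rewrite !yE|rewrite leNgt].
have di : d ord0 i * x ord0 i < 0 by apply: dM; rewrite -!yE.
have di0 : 0 < `|d ord0 i|.
  by rewrite normr_gt0; apply: contraTneq di => ->; rewrite mul0r ltxx.
have dip : `|d ord0 i| <= `|d ord0 p|.
  have [->//|ip] := eqVneq i p; apply: ltW; apply: le_lt_trans dom.
  by rewrite (bigD1 i)//= lerDl sumr_ge0.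
rewrite opposite_step// -?yE ?ieq; last first.
  by apply: ltW; apply: le_lt_trans tdp; rewrite ler_pM2l.
have [->|ip] := eqVneq i p; last by rewrite ztop// ieq gtrBl mulr_gt0.
by rewrite zp ltrD2l ltrN2 ltr_pM2l.
Qed.

(** The wrong sign at [j] is paid for by moving towards [e_j]: the point
[(1 - s) |x| + s e_j] of [B] has lost [s c] in each coordinate except [j],
where it has gained [s (1 - c)].  For the step [t = c] and [s = t delta] it
dominates [|x + t d|] strictly. *)
Lemma illuminates_near_constant (R : realType) (n : nat) (B : set 'rV[R]_n)
    (x d : 'rV[R]_n) (j : 'I_n) (c delta : R) :
  convex_set B -> one_symmetric B -> B x -> B (delta_mx ord0 j) ->
  0 < c < 1 -> 0 < delta <= 1 ->
  (forall i, `|x ord0 i| = c) ->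
  (forall i, i != j -> d ord0 i * x ord0 i < 0 /\ delta <= `|d ord0 i| <= 1) ->
  `|d ord0 j| < delta * (1 - c) ->
  illuminates B d x.
Proof.
move=> cB sB Bx Be /andP[c0 c1] /andP[dl0 dl1] xc dP dj.
have cd : c * delta < 1 by nra.
have := convex_combination (s := c * delta) cB Be (absv_mem sB Bx).
have cd01 : 0 <= c * delta <= 1 by rewrite mulr_ge0 ?ltW.
move=> /(_ cd01) H.
exists c => //; apply: (interior_box cB sB H) => i.
rewrite !mxE eqxx /= xc; case: (eqVneq i j) => [->|ij].
  rewrite (le_lt_trans (ler_normD _ _))// xc normrM gtr0_norm// mulr1.
  have -> : c * delta + (1 - c * delta) * c = c + c * (delta * (1 - c)) by ring.
  by rewrite ltrD2l ltr_pM2l.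
have [di /andP[di1 di2]] := dP i ij.
rewrite opposite_step ?xc//; last by rewrite ger_pMr.
rewrite mulr0 add0r.
have : c * delta * c < c * delta by rewrite gtr_pMr// mulr_gt0.
have : c * delta <= c * `|d ord0 i| by rewrite ler_pM2l.
by lra.
Qed.

(** * Two-colourings of a cycle *)

Lemma ord_succ_neq (n : nat) (j : 'I_n.+3) : (j + 1 == j) = false.
Proof. by rewrite -subr_eq0 addrC addKr oner_eq0. Qed.

(** A set closed under cyclic predecessors is empty or everything. *)
Lemma cyclic_entry (n : nat) (S : {set 'I_n.+3}) :
  S != finset.set0 -> S != finset.setT ->
  exists2 j, j \notin S & j + 1 \in S.
Proof.
move=> /set0Pn[x xS] SnT; apply: contrapT => noentry.
have pred_in j : j + 1 \in S -> j \in S.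
  by move=> jS; apply: contrapT => /negP nj; apply: noentry; exists j.
(* Every [y] is [x - (x - y)], reached in [x - y] steps. *)
have all_in (k : nat) : x - k%:R \in S.
  elim: k => [|k IH]; first by rewrite subr0.
  by apply: pred_in; rewrite -natr1 opprD addrA subrK.
move/eqP: SnT; apply; apply/finset.setP => y; rewrite finset.in_setT.
by have := all_in (x - y : 'I_n.+3); rewrite natr_Zp opprB addrC subrK.
Qed.

(** The colouring of [M] by [N] is extended by colouring each point outside [M]
like its predecessor; one point just after [M] is added at a time. *)
Lemma cyclic_fill (n : nat) (M N : {set 'I_n.+3}) :
  M != finset.set0 -> N \subset M ->
  exists2 T : {set 'I_n.+3}, (forall i, i \in M -> (i \in T) = (i \in N))
    & (forall p, p \notin M -> (p \in T) = (p - 1 \in T)).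
Proof.
have [k] := ubnP #|~: M|; elim: k M N => // k IH M N cardM M0 NM.
have [MT|MT] := eqVneq M finset.setT.
  by exists N => // p; rewrite MT finset.in_setT.
have [||j] := @cyclic_entry n (~: M).
- apply: contraNneq MT => /(congr1 (@finset.setC _)).
  by rewrite finset.setCK finset.setC0 => ->.
- apply: contraNneq M0 => /(congr1 (@finset.setC _)).
  by rewrite finset.setCK finset.setCT => ->.
rewrite !finset.in_setC negbK => jM pM; pose p := j + 1.
pose N' : {set 'I_n.+3} := if j \in N then p |: N else N.
have [|||T TM TnM] := IH (p |: M) N'.
- rewrite ltnS in cardM; apply: leq_trans cardM; apply: proper_card.
  rewrite properC; apply/properP; split; first exact: finset.subsetUr.
  by exists p => //; rewrite finset.in_setU1 eqxx.
- by apply/set0Pn; exists p; rewrite finset.in_setU1 eqxx.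
- rewrite /N'; case: ifP => _; first exact: finset.setUS.
  exact: fintype.subset_trans NM (finset.subsetUr _ _).
exists T => [i iM|q qM].
  rewrite TM ?finset.in_setU1 ?iM ?orbT// /N'; case: ifP => // _.
  by rewrite finset.in_setU1; case: eqP iM => // -> /=; rewrite (negbTE pM).
have [->|qp] := eqVneq q p; last first.
  by apply: TnM; rewrite finset.in_setU1 negb_or qp.
rewrite addrK !TM ?finset.in_setU1 ?eqxx ?jM ?orbT// /N'.
case: ifP => jN; last first.
  by rewrite jN; apply: contraNF pM; exact: (fintype.subsetP NM).
by rewrite !finset.in_setU1 eqxx jN orbT.
Qed.

Lemma card_cosingle (n : nat) (j : 'I_n.+3) : #|~: finset.set1 j| = n.+2.
Proof. by rewrite cardsCs finset.setCK cards1 card_ord subn1. Qed.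

Lemma singleton_nontrivial (n : nat) (T : {set 'I_n.+3}) (j : 'I_n.+3) :
  T = finset.set1 j \/ T = ~: finset.set1 j ->
  T != finset.set0 /\ T != finset.setT.
Proof.
by move=> Tj; split; apply: contraPneq (Tj) => ->; case=>
  /(congr1 (fun A : {set 'I_n.+3} => #|A|));
  rewrite ?cards0 ?cardsT ?card_ord ?card_cosingle ?cards1 => /eqP;
  rewrite ?eqSS ?(gtn_eqF (ltnSn _)).
Qed.

(** The first condition says that a run of the cyclic two-colouring given by [T]
begins at [p].  A colouring with a single exceptional point [j] has two runs,
and the second condition selects the long one. *)
Definition is_start (n : nat) (T : {set 'I_n.+3}) (p : 'I_n.+3) : bool :=
  ((p \in T) != (p - 1 \in T)) &&
  [forall j,
     ((T == finset.set1 j) || (T == ~: finset.set1 j)) ==> (p == j + 1)].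

Definition start (n : nat) (T : {set 'I_n.+3}) : 'I_n.+3 :=
  odflt ord0 [pick p | is_start T p].

(** Both conditions of [is_start] are symmetric in the two colours. *)
Lemma startC (n : nat) (T : {set 'I_n.+3}) : start (~: T) = start T.
Proof.
rewrite /start; congr odflt; apply: eq_pick => p; rewrite /is_start.
rewrite !finset.in_setC (inj_eq negb_inj); congr (_ && _).
apply: eq_forallb => j; congr (_ ==> _); rewrite orbC.
congr (_ || _); first exact: (inj_eq (@finset.setC_inj _)).
exact: (can2_eq (@finset.setCK _) (@finset.setCK _)).
Qed.

(** For a singleton or the complement of one, the exceptional point is unique
because the cycle has at least three points. *)
Lemma startP (n : nat) (T : {set 'I_n.+3}) :
  T != finset.set0 -> T != finset.setT -> is_start T (start T).
Proof.
move=> T0 TT; rewrite /start; case: pickP => // no.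
case: (boolP [exists j, (T == finset.set1 j) || (T == ~: finset.set1 j)]).
  move=> /existsP[j Tj]; have := no (j + 1); rewrite /is_start => /negbT/negP[].
  apply/andP; split.
    rewrite addrK; case/orP: Tj => /eqP ->;
    by rewrite ?finset.in_setC !finset.in_set1 ord_succ_neq eqxx.
  apply/forallP => i; apply/implyP => Ti; apply/eqP; congr (_ + 1).
  have ij (a b : 'I_n.+3) : finset.set1 a <> ~: finset.set1 b.
    move=> /(congr1 (fun A : {set 'I_n.+3} => #|A|)).
    by rewrite card_cosingle cards1.
  case/orP: Tj Ti => /eqP -> /orP[] /eqP; last 1 first.
  - by move/finset.setC_inj/finset.set1_inj.
  - by move/finset.set1_inj.
  - by move/ij.
  - by move/esym/ij.
move=> /existsPn none; have [j jT j1T] := cyclic_entry T0 TT.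
have := no (j + 1); rewrite /is_start addrK (negbTE jT) j1T /= => /negbT/negP[].
by apply/forallP => i; rewrite (negbTE (none i)).
Qed.

Lemma start_singleton (n : nat) (T : {set 'I_n.+3}) (j : 'I_n.+3) :
  T = finset.set1 j \/ T = ~: finset.set1 j -> start T = j + 1.
Proof.
move=> Tj; have [T0 TT] := singleton_nontrivial Tj.
have /andP[_ /forallP/(_ j)] := startP T0 TT.
by case: Tj => ->; rewrite eqxx ?orbT => /eqP.
Qed.

(** * The directions *)

(** For [eta <= 1/n] the modulus 1 at [p] exceeds the sum of all the others; a
small [eta] sits at the coordinate that is allowed to carry a wrong sign. *)
Definition weight (R : realType) (n : nat) (eta : R) (p i : 'I_n.+3) : R :=
  if i == p then 1 else if i == p - 1 then eta else n.+3%:R^-1.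

Definition direction (R : realType) (n : nat) (eta : R) (T : {set 'I_n.+3}) :
    'rV[R]_n.+3 :=
  \row_i ((-1) ^+ (i \in T) * weight eta (start T) i).

Lemma directionC (R : realType) (n : nat) (eta : R) (T : {set 'I_n.+3}) :
  direction eta (~: T) = - direction eta T.
Proof.
apply/rowP => i; rewrite !mxE startC finset.in_setC signrN mulNr //.
Qed.

Lemma weight_gt0 (R : realType) (n : nat) (eta : R) (p i : 'I_n.+3) :
  0 < eta -> 0 < weight eta p i.
Proof.
by move=> eta0; rewrite /weight; do 2?case: ifP.
Qed.

Lemma direction_norm (R : realType) (n : nat) (eta : R) (T : {set 'I_n.+3}) i :
  0 < eta -> `|direction eta T ord0 i| = weight eta (start T) i.
Proof.
by move=> eta0; rewrite mxE normrM normr_sign mul1r gtr0_norm// weight_gt0.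
Qed.

Lemma direction_neq0 (R : realType) (n : nat) (eta : R) (T : {set 'I_n.+3}) :
  0 < eta -> direction eta T != 0.
Proof.
move=> eta0; apply/eqP => /rowP/(_ ord0)/(congr1 Num.norm).
by rewrite direction_norm// mxE normr0; apply/eqP; rewrite gt_eqF// weight_gt0.
Qed.

(** The other [n - 1] weights are at most [1/n] each. *)
Lemma weight_dominant (R : realType) (n : nat) (eta : R) (p : 'I_n.+3) :
  0 < eta <= n.+3%:R^-1 ->
  \sum_(j | j != p) weight eta p j < weight eta p p.
Proof.
move=> /andP[eta0 eta1].
apply: (@le_lt_trans _ _ (\sum_(j < n.+3 | j != p) n.+3%:R^-1)).
  by apply: ler_sum => j jp; rewrite /weight (negbTE jp); case: ifP.
rewrite sumr_const [X in _ < X]/weight eqxx.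
have -> : #|[pred j : 'I_n.+3 | j != p]| = n.+2.
  by have := cardC1 p; rewrite card_ord /=; apply: etrans; apply: eq_card.
by rewrite -[_ *+ n.+2]mulr_natl ltr_pdivrMr ?ltr0n// mul1r ltr_nat.
Qed.

Definition direction_pairs (R : realType) (n : nat) (eta : R)
    (A : {set {set 'I_n.+3}}) : set 'rV[R]_n.+3 :=
  [set x | exists2 T, T \in A & x = direction eta T \/ x = - direction eta T].

Lemma direction_pairs_at_most (R : realType) (n : nat) (eta : R)
    (A : {set {set 'I_n.+3}}) : at_most_opposite_pairs #|A| (direction_pairs eta A).
Proof.
exists #|A|, (fun k => direction eta (enum_val k)); split=> //.
apply/seteqP; split=> [x [T TA xT]|x [k xk]] /=.
  by exists (enum_rank_in TA T); rewrite enum_rankK_in.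
by exists (enum_val k) => //; exact: enum_valP.
Qed.

(** One representative of each pair formed by a set and its complement. *)
Definition sets_avoiding0 (n : nat) : {set {set 'I_n.+3}} :=
  powerset (~: finset.set1 ord0).

Lemma card_sets_avoiding0 (n : nat) : #|sets_avoiding0 n| = (2 ^ n.+2)%N.
Proof. by rewrite card_powerset card_cosingle. Qed.

Lemma card_nonempty_sets_avoiding0 (n : nat) :
  #|sets_avoiding0 n :\ finset.set0| = (2 ^ n.+2 - 1)%N.
Proof.
have := cardsD1 finset.set0 (sets_avoiding0 n).
by rewrite card_sets_avoiding0 powersetE finset.sub0set => ->; rewrite addKn.
Qed.

Lemma sets_avoiding0_complement (n : nat) (T : {set 'I_n.+3}) :
  T \in sets_avoiding0 n \/ ~: T \in sets_avoiding0 n.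
Proof.
case: (boolP (ord0 \in T)) => T0; [right|left]; rewrite powersetE.
  by rewrite finset.setCS finset.sub1set.
by rewrite finset.subsetC finset.sub1set finset.in_setC.
Qed.

Lemma mem_direction_pairs (R : realType) (n : nat) (eta : R)
    (A : {set {set 'I_n.+3}}) (T : {set 'I_n.+3}) :
  T \in A \/ ~: T \in A -> direction_pairs eta A (direction eta T).
Proof.
case=> TA; first by exists T => //; left.
by exists (~: T) => //; right; rewrite directionC opprK.
Qed.

(** * Bodies in the class S *)

Lemma compact_boundary (R : realType) (n : nat) (B : set 'rV[R]_n) :
  compact B -> boundary B `<=` B.
Proof.
move=> cB x [clx _]; rewrite (closure_id B).1 //.
apply: compact_closed cB; exact: norm_hausdorff.
Qed.

(** An interior point can be pushed away from all the coordinate hyperplanes. *)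
Lemma positive_point (R : realType) (n : nat) (B : set 'rV[R]_n) :
  one_symmetric B -> B° !=set0 ->
  exists2 z, B z & forall i, 0 < z ord0 i.
Proof.
move=> sB [v /nbhs_ballP[e /= e0 ve]].
pose sg i : R := if 0 <= v ord0 i then 1 else -1.
pose w : 'rV[R]_n := \row_i (v ord0 i + (e / 2) * sg i).
have Bw : B w.
  apply: ve; split=> // i j; rewrite !mxE /ball /= (ord1 i).
  rewrite opprD addNKr normrN normrM.
  have -> : `|sg j| = 1 by rewrite /sg; case: ifP; rewrite ?normrN normr1.
  by rewrite mulr1 gtr0_norm; lra.
exists (absv w); first exact: absv_mem.
move=> i; rewrite !mxE normr_gt0 /sg; case: lerP => vi; apply/eqP; lra.
Qed.

(** The box spanned by a point with positive coordinates is a neighbourhood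
of 0. *)
Lemma boundary_neq0 (R : realType) (n : nat) (B : set 'rV[R]_n)
    (x : 'rV[R]_n) : convex_body B -> one_symmetric B ->
  boundary B x -> x != 0.
Proof.
move=> [_ cB iB] sB [_ nx]; apply/eqP => x0; apply: nx.
have [z Bz z0] := positive_point sB iB.
by apply: (interior_box cB sB Bz) => i; rewrite x0 mxE normr0.
Qed.

Lemma classS_basis (R : realType) (n : nat) (B : set 'rV[R]_n) (i : 'I_n) :
  classS B -> B (delta_mx ord0 i).
Proof. by move=> [[cB _ _] _ eB]; exact: compact_boundary. Qed.

(** A point with [|x_i| > 1], averaged with a point having positive coordinates,
would span a box containing [e_i] in its interior. *)
Lemma classS_cube (R : realType) (n : nat) (B : set 'rV[R]_n) :
  classS B -> B `<=` cube R n.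
Proof.
move=> [[_ cB iB] sB eB] x Bx i; rewrite -ler_norml leNgt; apply/negP => xi.
have [z Bz z0] := positive_point sB iB.
have [_] := eB i; apply.
pose a := `|x ord0 i|.
have a0 : 0 < a by apply: lt_trans xi.
have s01 : 0 <= (a - 1) / (2 * a) <= 1.
  apply/andP; split; first by rewrite divr_ge0 ?subr_ge0 ?mulr_ge0 ?ltW.
  by rewrite ler_pdivrMr ?mulr_gt0// mul1r /a; lra.
have Bu := convex_combination cB Bz (absv_mem sB Bx) s01.
apply: (interior_box cB sB Bu) => j; rewrite !mxE eqxx /=.
have s0 : 0 < (a - 1) / (2 * a) by rewrite divr_gt0 ?subr_gt0 ?mulr_gt0.
have s1 : (a - 1) / (2 * a) < 1.
  by rewrite ltr_pdivrMr ?mulr_gt0// mul1r; lra.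
have [ji|ji] := eqVneq j i; last first.
  rewrite normr0; apply: ltr_wpDr; last exact: mulr_gt0.
  by apply: mulr_ge0 => //; rewrite subr_ge0 ltW.
rewrite ji normr1 -/a.
have -> : (1 - (a - 1) / (2 * a)) * a = (a + 1) / 2 by field; rewrite gt_eqF.
have := mulr_gt0 s0 (z0 i); rewrite /a in xi *; lra.
Qed.

(** The point [(1, ..., 1)] is not in [B], since otherwise [B] would contain the
cube; as [B] is closed, a slightly smaller diagonal point is not in [B]
either.  The bound is uniform in [a] because the directions are chosen before
the boundary point. *)
Lemma noncube_gap (R : realType) (n : nat) (B : set 'rV[R]_n) :
  classS B -> B <> cube R n ->
  exists2 r : R, 0 < r <= 1
    & forall a : R, B (const_mx a) -> r < 1 - `|a|.
Proof.
move=> SB nB; have [[compB cB iB] sB _] := SB.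
have n1 : ~ B (const_mx 1).
  move=> B1; apply: nB; apply/seteqP; split; first exact: classS_cube.
  by move=> x x1; apply: (box_subset cB sB B1) => i; rewrite mxE ler_norml.
have : open (~` B).
  by apply: closed_openC; apply: compact_closed compB; exact: norm_hausdorff.
move=> /(_ _ n1)/nbhs_ballP[e /= e0 eB].
pose r := Num.min (e / 2) (1 / 2).
have r0 : 0 < r by rewrite lt_min; apply/andP; split; lra.
have re : r <= e / 2 by rewrite ge_min lexx.
have r1 : r <= 1 / 2 by rewrite ge_min lexx orbT.
exists r; first by apply/andP; split; lra.
move=> a Ba; rewrite ltrBrDr -ltrBrDl ltNge; apply/negP => ar.
apply: (eB (const_mx (1 - r))).
  by split=> // i j; rewrite !mxE /ball /= opprB addrC subrK gtr0_norm//; lra.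
by apply: (box_subset cB sB (absv_mem sB Ba)) => i; rewrite !mxE ger0_norm//; lra.
Qed.

(** * Illumination by the family *)

Lemma direction_sign (R : realType) (n : nat) (eta : R) (T : {set 'I_n.+3}) (a : R)
    (i : 'I_n.+3) :
  0 < eta -> a != 0 -> (i \in T) = (0 < a) -> direction eta T ord0 i * a < 0.
Proof.
move=> eta0 a0 iT; rewrite mxE iT mulrAC pmulr_llt0 ?weight_gt0//.
have [a1|a1] := ltP 0 a; first by rewrite expr1 mulN1r oppr_lt0.
by rewrite expr0 mul1r lt_neqAle a0.
Qed.

Lemma direction_illuminates (R : realType) (n : nat) (eta : R)
    (B : set 'rV[R]_n.+3) (T : {set 'I_n.+3}) (x : 'rV[R]_n.+3) :
  convex_set B -> one_symmetric B -> 0 < eta <= n.+3%:R^-1 -> B x -> x != 0 ->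
  (forall i, `|x ord0 i| <= `|x ord0 (start T)|) ->
  (forall i, `|x ord0 i| = `|x ord0 (start T)| -> (i \in T) = (0 < x ord0 i)) ->
  illuminates B (direction eta T) x.
Proof.
move=> cB sB eta01 Bx x0 xmax xsign.
have /andP[eta0 _] := eta01.
apply: (illuminates_dominant (p := start T) cB sB Bx xmax) => [i ip|].
  apply: direction_sign => //; last exact: xsign.
  apply: contra_neq x0 => xi; apply/rowP => j; rewrite mxE.
  by apply/eqP; rewrite -normr_le0 (le_trans (xmax j))// -ip xi normr0.
rewrite direction_norm//; under eq_bigr do rewrite direction_norm//.
exact: weight_dominant.
Qed.

(** The set [T] is found as a filling of [N] if [N] is neither empty nor [M], and
otherwise as a singleton or the complement of one, placed just before a point
of [M]. *)
Lemma illuminated_or_constant (R : realType) (n : nat) (eta : R)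
    (B : set 'rV[R]_n.+3) (x : 'rV[R]_n.+3) :
  convex_set B -> one_symmetric B -> 0 < eta <= n.+3%:R^-1 -> B x -> x != 0 ->
  (exists2 T : {set 'I_n.+3}, T != finset.set0 /\ T != finset.setT
     & illuminates B (direction eta T) x) \/
  (exists2 a, a != 0 & x = const_mx a).
Proof.
move=> cB sB eta01 Bx x0.
have [q qmax] : exists q, forall i, `|x ord0 i| <= `|x ord0 q|.
  have [|q _ qmax] := @Order.TotalTheory.arg_maxP _ _ _ (ord0 : 'I_n.+3) predT
     (fun i => `|x ord0 i|); first by [].
  by exists q => i; exact: qmax.
have xq : x ord0 q != 0.
  apply: contra_neq x0 => xq; apply/rowP => j; rewrite mxE.
  by apply/eqP; rewrite -normr_le0 (le_trans (qmax j))// xq normr0.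
pose M : {set 'I_n.+3} := [set i | `|x ord0 i| == `|x ord0 q|]%SET.
pose N : {set 'I_n.+3} := [set i | (i \in M) && (0 < x ord0 i)]%SET.
have qM : q \in M by rewrite finset.in_set.
have MP i : (i \in M) = (`|x ord0 i| == `|x ord0 q|) by rewrite finset.in_set.
have NP i : i \in M -> (i \in N) = (0 < x ord0 i).
  by move=> iM; rewrite finset.in_set iM.
have NM : N \subset M.
  by apply/fintype.subsetP => i; rewrite finset.in_set => /andP[].
have M0 : M != finset.set0 by apply/set0Pn; exists q.
have final (T : {set 'I_n.+3}) : T != finset.set0 -> T != finset.setT ->
    start T \in M -> (forall i, i \in M -> (i \in T) = (i \in N)) ->
    exists2 T : {set 'I_n.+3}, T != finset.set0 /\ T != finset.setT
      & illuminates B (direction eta T) x.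
  move=> T0 TT; rewrite MP => /eqP stM TN; exists T => //.
  apply: direction_illuminates => // i; rewrite stM // => /eqP.
  rewrite -MP => iM.
  by rewrite TN ?NP.
have [N0|N0] := eqVneq N finset.set0;
  last have [NeM|NnM] := eqVneq N M; last first.
- left; have [T TN Tfill] := cyclic_fill M0 NM.
  have T0 : T != finset.set0.
    have /set0Pn[i iN] := N0; apply/set0Pn; exists i; rewrite TN//.
    exact: (fintype.subsetP NM).
  have TT : T != finset.setT.
    apply: contra_neq NnM => TT; apply/eqP; rewrite finset.eqEsubset NM.
    by apply/fintype.subsetP => i iM; rewrite -TN// TT finset.in_setT.
  apply: (final T) => //; apply: contraT => /Tfill.
  by have /andP[+ _] := startP T0 TT => /eqP.
- have [MT|MT] := eqVneq M finset.setT.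
    right; exists (x ord0 q) => //; apply/rowP => i; rewrite mxE.
    have iM j : j \in M by rewrite MT finset.in_setT.
    have := MP i; rewrite iM => /esym/eqP.
    by rewrite !gtr0_norm// -NP// NeM.
  left; have [j jM j1M] := cyclic_entry M0 MT.
  have jT := singleton_nontrivial (or_intror (erefl (~: finset.set1 j))).
  apply: (final (~: finset.set1 j)); rewrite ?jT.1 ?jT.2//.
    by rewrite (start_singleton (or_intror erefl)).
  move=> i iM; rewrite NeM iM finset.in_setC finset.in_set1.
  by apply: contraNneq jM => <-.
have [MT|MT] := eqVneq M finset.setT.
  right; exists (x ord0 q) => //; apply/rowP => i; rewrite mxE.
  have iM j : j \in M by rewrite MT finset.in_setT.
  have := MP i; rewrite iM => /esym/eqP.
  have xneg j : x ord0 j <= 0 by rewrite leNgt -NP// N0 finset.in_set0.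
  by rewrite !ler0_norm// => /oppr_inj.
left; have [j jM j1M] := cyclic_entry M0 MT.
have jT := singleton_nontrivial (or_introl (erefl (finset.set1 j))).
apply: (final (finset.set1 j)); rewrite ?jT.1 ?jT.2//.
  by rewrite (start_singleton (or_introl erefl)).
move=> i iM; rewrite N0 finset.in_set0 finset.in_set1.
by apply: contraNF jM => /eqP <-.
Qed.

Lemma full_illuminating (R : realType) (n : nat) (eta : R)
    (B : set 'rV[R]_n.+3) :
  classS B -> 0 < eta <= n.+3%:R^-1 ->
  illuminating_set B (direction_pairs eta (sets_avoiding0 n)).
Proof.
move=> [[compB cB iB] sB _] eta01; have /andP[eta0 _] := eta01.
split=> [d [T _ [->|->]]|x bx]; rewrite ?oppr_eq0 ?direction_neq0//.
have Bx : B x by exact: compact_boundary.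
have x0 : x != 0 by apply: boundary_neq0 bx.
suff [T xT] : exists T : {set 'I_n.+3}, illuminates B (direction eta T) x.
  exists (direction eta T) => //; apply: mem_direction_pairs.
  exact: sets_avoiding0_complement.
have [[T _ xT]|[a a0 xa]] := illuminated_or_constant cB sB eta01 Bx x0.
  by exists T.
exists (if 0 < a then finset.setT else finset.set0 : {set 'I_n.+3}).
apply: direction_illuminates => // i; rewrite xa !mxE // => _.
by case: ifP; rewrite ?finset.in_setT ?finset.in_set0.
Qed.

(** A constant point is illuminated by the direction of [{0}] or of its
complement, whose distinguished coordinate is 1, so that the coordinate 0 with
the wrong sign is the one of modulus [eta]. *)
Lemma reduced_illuminating (R : realType) (n : nat) (r : R)
    (B : set 'rV[R]_n.+3) :
  classS B -> 0 < r <= 1 ->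
  (forall a : R, B (const_mx a) -> r < 1 - `|a|) ->
  illuminating_set B
    (direction_pairs (n.+3%:R^-1 * r) (sets_avoiding0 n :\ finset.set0)).
Proof.
move=> SB /andP[r0 r1] gap; have [[compB cB iB] sB _] := SB.
set delta : R := n.+3%:R^-1; set eta := delta * r.
have dl0 : 0 < delta by rewrite invr_gt0 ltr0n.
have dl1 : delta <= 1 by rewrite invf_le1 ?ltr0n// ler1n.
have eta01 : 0 < eta <= n.+3%:R^-1 by rewrite mulr_gt0 //= ger_pMr.
have /andP[eta0 _] := eta01.
split=> [d [T _ [->|->]]|x bx]; rewrite ?oppr_eq0 ?direction_neq0//.
have Bx : B x by exact: compact_boundary.
have x0 : x != 0 by apply: boundary_neq0 bx.
suff [T [T0 TT] xT] : exists2 T : {set 'I_n.+3},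
    T != finset.set0 /\ T != finset.setT & illuminates B (direction eta T) x.
  exists (direction eta T) => //; apply: mem_direction_pairs.
  rewrite !finset.in_setD1 T0 /= -[_ == _](inj_eq (@finset.setC_inj _)).
  rewrite finset.setCK finset.setC0 TT; exact: sets_avoiding0_complement.
have [//|[a a0 xa]] := illuminated_or_constant cB sB eta01 Bx x0.
have ra : r < 1 - `|a| by apply: gap; rewrite -xa.
pose T : {set 'I_n.+3} :=
  if 0 < a then ~: finset.set1 ord0 else finset.set1 ord0.
have Tj : T = finset.set1 ord0 \/ T = ~: finset.set1 ord0.
  by rewrite /T; case: ifP; [right|left].
exists T; first exact: (singleton_nontrivial Tj).
have a1 : 0 < `|a| < 1 by rewrite normr_gt0 a0 /=; lra.
apply: (@illuminates_near_constant _ _ _ _ _ ord0 `|a| delta) => //.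
- exact: classS_basis.
- by rewrite dl0.
- by move=> i; rewrite xa mxE.
- move=> i i0; split.
    have -> : x ord0 i = a by rewrite xa mxE.
    apply: direction_sign => //.
    by rewrite /T; case: ifP => _;
      rewrite ?finset.in_setC finset.in_set1 (negbTE i0).
  rewrite direction_norm// (start_singleton Tj) /weight addrK (negbTE i0).
  by case: ifP; rewrite ?lexx ?dl1.
rewrite direction_norm// (start_singleton Tj) /weight addrK eqxx.
rewrite eq_sym ord_succ_neq.
by rewrite ltr_pM2l.
Qed.

(** * X-raying *)

Lemma xrayed_of_pairs (R : realType) (n m : nat) (B D : set 'rV[R]_n) :
  at_most_opposite_pairs m D -> illuminating_set B D ->
  exists2 k, (k <= m)%N & exists u : 'I_k -> 'rV[R]_n, xrayed_by B u.
Proof.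
move=> [k [d [km DE]]] [D0 Dill]; exists k => //; exists d; split.
  by move=> i; apply: D0; rewrite DE; exists i; left.
move=> p /Dill[v]; rewrite DE => -[i [->|->]] [e e0 ie]; exists i.
  by exists (p + e *: d i); split => //; exists e.
exists (p + e *: - d i); split => //; exists (- e) => //.
by rewrite scaleNr scalerN.
Qed.

Lemma xray_number_exists (R : realType) (n k : nat) (B : set 'rV[R]_n)
    (u : 'I_k -> 'rV[R]_n) :
  xrayed_by B u -> exists M, is_xray_number B M.
Proof.
move=> xu; pose P m := `[< exists u : 'I_m -> 'rV[R]_n, xrayed_by B u >].
have exP : exists m, P m by exists k; apply/asboolP; exists u.
case: (ex_minnP exP) => M /asboolP uM minM; exists M; split=> // M' u' xu'.
by apply: minM; apply/asboolP; exists u'.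
Qed.

Theorem mainTheorem3 (R : realType) (n : nat) (B : set 'rV[R]_n)
    (hn : (3 <= n)%N) (hB : classS B) :
  [/\ exists2 D : set 'rV[R]_n,
        at_most_opposite_pairs (2 ^ (n - 1)) D & illuminating_set B D,
      B <> cube R n ->
      exists2 D : set 'rV[R]_n,
        at_most_opposite_pairs (2 ^ (n - 1) - 1) D & illuminating_set B D
    & exists2 M : nat, is_xray_number B M
      & [/\ (M <= 2 ^ (n - 1))%N, (M <= 3 * 2 ^ (n - 2))%N
          & B <> cube R n -> (M <= 2 ^ (n - 1) - 1)%N]].
Proof.
case: n hn B hB => [|[|[|n]]] // _ B hB; rewrite !subSS !subn0.
have full : exists2 D : set 'rV[R]_n.+3,
    at_most_opposite_pairs (2 ^ n.+2) D & illuminating_set B D.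
  exists (direction_pairs n.+3%:R^-1 (sets_avoiding0 n)); last first.
    by apply: full_illuminating => //; rewrite invr_gt0 ltr0n lexx.
  by rewrite -card_sets_avoiding0; exact: direction_pairs_at_most.
have reduced : B <> cube R n.+3 -> exists2 D : set 'rV[R]_n.+3,
    at_most_opposite_pairs (2 ^ n.+2 - 1) D & illuminating_set B D.
  move=> /(noncube_gap hB)[r r01 gap].
  exists (direction_pairs (n.+3%:R^-1 * r)
            (sets_avoiding0 n :\ finset.set0)); last first.
    exact: reduced_illuminating.
  by rewrite -card_nonempty_sets_avoiding0; exact: direction_pairs_at_most.
have [D Dk illD] := full.
have [k km [u xu]] := xrayed_of_pairs Dk illD.
have [M XM] := xray_number_exists xu.
have leM m E : at_most_opposite_pairs m E -> illuminating_set B E -> (M <= m)%N.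
  move=> mE illE; have [k' km' [u' xu']] := xrayed_of_pairs mE illE.
  exact: leq_trans (XM.2 _ _ xu') km'.
have M2 : (M <= 2 ^ n.+2)%N by exact: leM illD.
split=> //; exists M => //; split=> //.
  by apply: leq_trans M2 _; rewrite expnS leq_mul2r orbT.
by move=> /reduced[E Ek illE]; exact: leM illE.
Qed.
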